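(* Let $G_{V,0}^t$ and $G_{V,0}^a$ be the one-point functions for trees and for connected subgraphs on the complete graph $\mathbb{K}_V$ (as defined in the context). Then, both for $*=t$ and for $*=a$, for all $s\ge 0$, and for all real sequences $(p_V)$ with $p_V\le 1+sV^{-1/2}$ and $\lim_{V\to\infty}p_V=p\in[0,1]$, $$\lim_{V\to\infty}G_{V,0}^{*}(p_V)=\sum_{n=1}^\infty\frac{n^{n-1}}{n!}\left(\frac{p}{e}\right)^{n-1}=-\frac{e}{p}W_0\left(-\frac{p}{e}\right),$$ where $W_0$ is the principal branch of the Lambert function. In particular, if $p=1$ then $\lim_{V\to\infty}G_{V,0}^{*}(p_V)=e$.
   Context: For an integer $V\ge 2$, $\mathbb{K}_V$ is the complete graph with labelled vertex set $\{0,1,\dots,V-1\}$ and edge set $\{\{x,y\}: x\ne y\}$. A subgraph consists of a nonempty vertex subset together with a set of edges between those vertices; a tree is a connected acyclic subgraph. The single-vertex subgraph with no edges is a tree (and a connected subgraph). $|T|$, $|A|$ denote the number of edges of $T$, $A$. One-point functions: $G_{V,0}^t(p)=\sum_{T\ni 0}\left(\frac{p}{eV}\right)^{|T|}$, $G_{V,0}^a(p)=\sum_{A\ni 0}\left(\frac{p}{eV}\right)^{|A|}$, where the first sum is over all trees $T$ in $\mathbb{K}_V$ containing the vertex $0$ and the second is over all connected subgraphs $A$ of $\mathbb{K}_V$ containing the vertex $0$. The principal branch $W_0$ of the Lambert function solves $W_0(z)e^{W_0(z)}=z$ and has power series $W_0(z)=\sum_{n=1}^\infty\frac{(-n)^{n-1}}{n!}z^n$;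 in particular $W_0(-1/e)=-1$. Conventions: $0^0=1$, and for $p=0$ the expression $-\frac{e}{p}W_0(-\frac{p}{e})$ is understood as its limiting value $1$. Here $e$ is the base of natural logarithms. *)

(* Defs.v *)
From HB Require Import structures.
From mathcomp Require Import all_boot all_order all_algebra.
From mathcomp Require Import all_classical all_reals all_analysis.

Set Implicit Arguments.
Unset Strict Implicit.
Unset Printing Implicit Defensive.

Import Order.TTheory GRing.Theory Num.Theory.
Import numFieldNormedType.Exports.

Local Open Scope classical_set_scope.
Local Open Scope ring_scope.

(* A candidate subgraph of the complete graph on 'I_V is a pair (vertex set,
   edge set); an edge {x, y} is encoded as the two-element set [set x; y].
   Not every pair is a subgraph, see [is_subgraph]. *)
Definition subgraph (V : nat) : Type := ({set 'I_V} * {set {set 'I_V}})%type.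

Definition verts (V : nat) (A : subgraph V) : {set 'I_V} := A.1.
Definition edges (V : nat) (A : subgraph V) : {set {set 'I_V}} := A.2.

Definition is_subgraph (V : nat) (A : subgraph V) : bool :=
  (verts A != finset.set0) &&
  [forall e in edges A, (#|e| == 2%N) && (e \subset verts A)].

Definition adj (V : nat) (A : subgraph V) : rel 'I_V :=
  fun x y => (x != y) && ([set x; y]%SET \in edges A).

Definition graph_connected (V : nat) (A : subgraph V) : bool :=
  [forall x in verts A, forall y in verts A, connect (adj A) x y].

(* The bound on the size discards [:: x; y], which is a [ucycle] as soon as
   {x, y} is an edge. *)
Definition graph_acyclic (V : nat) (A : subgraph V) : Prop :=
  forall c : seq 'I_V, (2 < size c)%N -> ~ ucycle (adj A) c.

Definition is_connected_subgraph (V : nat) (A : subgraph V) : bool :=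
  is_subgraph A && graph_connected A.

Definition is_tree (V : nat) (A : subgraph V) : bool :=
  is_connected_subgraph A && `[< graph_acyclic A >].

(* Stated through the value of x, so that no positivity proof for V is
   needed to name the vertex 0. *)
Definition contains0 (V : nat) (A : subgraph V) : bool :=
  [exists x in verts A, nat_of_ord x == 0%N].

Definition Gt (R : realType) (V : nat) (p : R) : R :=
  \sum_(T : {set 'I_V} * {set {set 'I_V}} | is_tree T && contains0 T)
    (p / (expR 1 * V%:R)) ^+ #|edges T|.

Definition Ga (R : realType) (V : nat) (p : R) : R :=
  \sum_(A : {set 'I_V} * {set {set 'I_V}} |
      is_connected_subgraph A && contains0 A)
    (p / (expR 1 * V%:R)) ^+ #|edges A|.

(* Real principal branch: for z >= -1/e, the unique w >= -1 with
   w * e^w = z (and the junk value 0 for z < -1/e). *)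
Definition lambertW0 (R : realType) (z : R) : R :=
  xget 0 [set w : R | -1 <= w /\ w * expR w = z].

(* -(e/p) W_0(-p/e), extended to p = 0 by its limit 1. *)
Definition lambert_ratio (R : realType) (p : R) : R :=
  if p == 0 then 1 else - (expR 1 / p) * lambertW0 (- (p / expR 1)).

Definition lambert_partial_sum (R : realType) (p : R) (N : nat) : R :=
  \sum_(1 <= n < N) n%:R ^+ n.-1 / n`!%:R * (p / expR 1) ^+ n.-1.

(* Main.v *)
Require Import Defs.
From HB Require Import structures.
From mathcomp Require Import all_boot all_order all_algebra.
From mathcomp Require Import all_classical all_reals all_analysis.
From mathcomp Require Import ring lra.

(** Write V = n + 1 and x = p / e.  By Cayley's formula there are
    (m + 1)^(m - 1) trees on a given set of m + 1 vertices, hence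
      Gt q = sum_m C(n, m) (m + 1)^(m - 1) (q / (e V))^m,
    and for fixed m the m-th term tends to (m + 1)^(m - 1) / m! x^m, which is
    the m-th term of the series of the theorem ([cvg_tree_term]).  Cayley's
    formula is obtained for forests with k roots, where it is k (k + u)^(u - 1)
    for u further vertices and follows by induction from the binomial theorem,
    deleting all the roots at once ([card_forests]); trees containing 0 are
    identified with their parent maps towards 0 ([tree_setE]).

    A connected graph contains a spanning tree, and its other edges form a
    set of pairs of vertices, nonempty unless the graph is a tree.  Hence
    [Ga q - Gt q] is at most the sum for [Gt `|q|] with the m-th term multiplied
    by (1 + y)^C(m+1,2) - 1, where y = |q| / (e V) ([Ga_sub_Gt]), and this factor
    tends to 0 for fixed m.  It remains to exchange limit and sum, by
    domination.  The factor n (n - 1) ... (n - m + 1) / V^m of the m-th term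
    is at most exp (- C(m+1,2) / V).  This beats both (1 + s / sqrt V)^m, at most
    exp (s m / sqrt V), which the critical window allows, and
    (1 + y)^C(m+1,2), at most exp (3/4 C(m+1,2) / V) because e >= 2: what is left
    is at most exp (2 s^2) ([tree_term_dominated]).  So the terms are dominated
    by a multiple of the series at p = 1, for trees and for connected graphs
    alike; the crude bound for the latter suffices only because 1/e < 1.

    The convergence and the value of the limit series both come from Abel's
    polynomials e_m(y) = y (y + m)^(m - 1) / m!, which satisfy
    sum_k e_k(y) e_(m-k)(z) = e_m(y + z) ([abelD]).  So the sums
    E(y) = sum_m e_m(y) x^m are multiplicative in y, up to truncation, and
    E(1) = E(1/N)^N tends to exp E'(0).  Since E(1) = L is the series of the
    theorem and E'(0) = x L, this gives L = exp (x L) ([abel_sum_expR]);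
    applied to partial sums, the same argument bounds x L by 1 when
    x <= 1/e ([abel_psum_bound]), without Stirling's formula.  Thus - x L is a
    solution w >= -1 of w e^w = - x, i.e. W0 (- x) ([abel_sum_lambert]), and at
    p = 1 it is -1 by uniqueness ([abel_sum_critical]). *)

Set Implicit Arguments.
Unset Strict Implicit.
Unset Printing Implicit Defensive.

Import Order.TTheory GRing.Theory Num.Theory.
Import numFieldNormedType.Exports.

Local Open Scope classical_set_scope.
Local Open Scope ring_scope.

(** * Counting rooted forests *)

Section Forests.
Local Open Scope nat_scope.
Local Open Scope set_scope.
Variable T : finType.
Implicit Types (R U J : {set T}) (f g h : {ffun T -> T}).

(** Parent maps of the forests with set of roots R and set of other vertices
    U.  They are the identity off U, so that each forest is counted once. *)
Definition forests R U : {set {ffun T -> T}} :=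
  [set f : {ffun T -> T} | [&& [forall x, (x \notin U) ==> (f x == x)],
               [forall x in U, f x \in R :|: U] &
               `[< forall x, x \in U -> exists k, iter k f x \in R >]]]%SET.

Lemma forestsP R U f :
  reflect [/\ forall x, x \notin U -> f x = x,
              forall x, x \in U -> f x \in R :|: U &
              forall x, x \in U -> exists k, iter k f x \in R]
          (f \in forests R U).
Proof.
rewrite inE; apply: (iffP and3P) => -[H1 H2 H3]; split.
- by move=> x /(implyP (forallP H1 x)) /eqP.
- by move=> x; move/forall_inP : H2; apply.
- exact/asboolP.
- by apply/forallP => x; apply/implyP => /H1 ->.
- exact/forall_inP.
- exact/asboolP.
Qed.

Lemma big_subsets_card (M : Type) (idx : M) (op : Monoid.com_law idx) U (F : nat -> M) :
  \big[op/idx]_(J in powerset U) F #|J| =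
  \big[op/idx]_(j < #|U|.+1) iter 'C(#|U|, j) (op (F j)) idx.
Proof.
rewrite (partition_big (fun J : {set T} => inord #|J| : 'I_#|U|.+1) xpredT) //=.
apply: eq_bigr => j _.
have E (J : {set T}) : (J \in powerset U) && (inord #|J| == j) =
   (J \in [set A : {set T} | A \subset U & #|A| == j]%SET).
  rewrite !inE; case: (boolP (J \subset U)) => //= JU.
  by rewrite -val_eqE /= inordK // ltnS subset_leq_card.
rewrite -(cards_draws U j) -big_const (eq_bigl _ _ E).
by apply: eq_bigr => J; rewrite inE => /andP[_ /eqP ->].
Qed.

Definition maps_into R J : {set {ffun T -> T}} :=
  [set f : {ffun T -> T} in family (fun x => if x \in J then mem R else mem (pred1 x))]%SET.

Lemma maps_intoP R J f :
  reflect ((forall x, x \notin J -> f x = x) /\ (forall x, x \in J -> f x \in R))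
    (f \in maps_into R J).
Proof.
rewrite inE; apply: (iffP familyP) => [H|[H1 H2] x].
- split=> x; have := H x; first by case: ifP => // _ /eqP.
  by case: ifP.
- case: ifPn => [/H2//|/H1]; by rewrite !inE => ->.
Qed.

Lemma card_maps_into R J : #|maps_into R J| = #|R| ^ #|J|.
Proof.
rewrite cardsE card_family.
rewrite foldrE big_image /=.
transitivity (\prod_(x : T) (if x \in J then #|R| else 1)).
  by apply: eq_bigr => x _; case: ifP => // _; exact: card1.
by rewrite -big_mkcond /= prod_nat_const.
Qed.

Definition restrict J f : {ffun T -> T} := [ffun x => if x \in J then f x else x].

(** Fix the set J of the children of the roots.  A forest then consists of two
    independent choices: a root for each element of J, and a forest on the
    other vertices with J as set of roots. *)
Lemma card_forests_first R U J : [disjoint R & U]%B -> J \subset U ->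
  #|[set f in forests R U | [set x in U | f x \in R]%SET == J]%SET| =
  #|R| ^ #|J| * #|forests J (U :\: J)|.
Proof.
move=> dRU sJU; rewrite -card_maps_into -cardsX.
have UR x : x \in U -> x \in R -> False.
  by move=> xU xR; have := disjointFr dRU xR; rewrite xU.
set A := [set f in _ | _]%SET.
pose split f := (restrict J f, restrict (U :\: J) f).
have AP f : f \in A -> [/\ forall x, x \notin U -> f x = x,
              forall x, x \in U -> f x \in R :|: U,
              forall x, x \in U -> exists k, iter k f x \in R &
              forall x, x \in U -> (f x \in R) = (x \in J)].
  rewrite inE => /andP[/forestsP[H1 H2 H3] /eqP EJ]; split => // x xU.
  by rewrite -EJ inE xU.
rewrite -(card_in_imset (f := split) (D := mem A)); last first.
  move=> f g /AP[f1 _ _ _] /AP[g1 _ _ _] [/ffunP E1 /ffunP E2].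
  apply/ffunP => x; move: (E1 x) (E2 x); rewrite !ffunE inE.
  case: ifP => // xJ _; case: ifP => //= /negbT xU _.
  by rewrite f1 // g1.
apply: eq_card => -[g h]; rewrite inE /=.
apply/imsetP/andP => [[f /AP[H1 H2 H3 H4] [-> ->]]|[/maps_intoP[g1 g2] /forestsP[h1 h2 h3]]].
  split.
    apply/maps_intoP; split=> x; rewrite ffunE; first by move/negPf => ->.
    by move=> xJ; rewrite xJ H4 // (fintype.subsetP sJU).
  have step x : x \in U :\: J -> restrict (U :\: J) f x = f x by rewrite ffunE => ->.
  have stepU x : x \in U :\: J -> f x \in U.
    move=> xU; move: (xU); rewrite inE => /andP[xJ xU'].
    by have := H2 _ xU'; rewrite inE H4 // (negPf xJ).
  apply/forestsP; split.
  - by move=> x xU; rewrite ffunE (negPf xU).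
  - by move=> x xU; rewrite step // !inE stepU // andbT orbN.
  - move=> x xU.
    have [k] : exists k, iter k f x \in R by apply: H3; case/setDP: xU.
    elim: k x xU => [|k IH] x xU; first by case/setDP: xU => /UR xR _ /xR.
    rewrite iterSr => kR; case: (boolP (f x \in J)) => fxJ.
      by exists 1; rewrite /= step.
    have [|k' Hk'] := IH (f x) _ kR; first by rewrite inE fxJ stepU.
    by exists k'.+1; rewrite iterSr step.
pose f := [ffun x => if x \in J then g x else h x].
have fJ x : x \in J -> f x = g x by rewrite ffunE => ->.
have fN x : x \notin J -> f x = h x by rewrite ffunE => /negPf ->.
have hU x : x \in U -> x \notin J -> h x \in U.
  move=> xU xJ; have := h2 x; rewrite !inE xU xJ => /(_ isT).
  by case/orP => [/(fintype.subsetP sJU)//|/andP[]].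
exists f.
  rewrite inE; apply/andP; split.
    apply/forestsP; split.
    - move=> x xU; have xJ : x \notin J by apply: contra xU => /(fintype.subsetP sJU).
      by rewrite fN // h1 // inE (negPf xU) andbF.
    - move=> x xU; case: (boolP (x \in J)) => xJ.
        by rewrite fJ // inE g2.
      by rewrite fN // inE hU // orbT.
    - have reach k : forall x, x \in U -> iter k h x \in J -> exists k', iter k' f x \in R.
        elim: k => [|k IH] x xU.
          by move=> /= xJ; exists 1; rewrite /= fJ // g2.
        rewrite iterSr => kJ; case: (boolP (x \in J)) => xJ.
          by exists 1; rewrite /= fJ // g2.
        have [k' Hk'] := IH _ (hU _ xU xJ) kJ.
        by exists k'.+1; rewrite iterSr fN.
      move=> x xU; case: (boolP (x \in J)) => xJ.
        exact: (reach 0).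
      have [|k Hk] := h3 x; first by rewrite inE xJ.
      exact: reach Hk.
  apply/eqP/finset.setP => x; rewrite inE; case: (boolP (x \in J)) => xJ.
    by rewrite (fintype.subsetP sJU) //= fJ // g2.
  apply/negP => /andP[xU]; rewrite fN // => /UR; apply; exact: hU.
congr (_, _); apply/ffunP => x; rewrite !ffunE.
  by case: (boolP (x \in J)) => [//|xJ]; exact: g1.
case: (boolP (x \in U :\: J)) => [|xU]; last exact: h1.
by rewrite inE => /andP[/negPf ->].
Qed.

Lemma card_forests_rec R U : [disjoint R & U]%B ->
  #|forests R U| =
  \sum_(J in powerset U) #|R| ^ #|J| * #|forests J (U :\: J)|.
Proof.
move=> dRU; rewrite -sum1_card.
rewrite (partition_big (fun f : {ffun T -> T} => [set x in U | f x \in R]%SET)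
  (mem (powerset U))) /=; last first.
  by move=> f _; rewrite inE; apply/fintype.subsetP => x; rewrite inE => /andP[].
apply: eq_bigr => J; rewrite inE => /(card_forests_first dRU) <-.
by rewrite -sum1_card; apply: eq_bigl => f; rewrite [in RHS]inE.
Qed.

(** This is k (k + u)^(u - 1), written without the exponent -1 of u = 0. *)
Definition forest_number k u := if u is u'.+1 then k * (k + u) ^ u' else 1.

(** Since C(u+1, j+1) (j+1) = (u+1) C(u, j), the right-hand side is k times the
    binomial expansion of (k + (u + 1))^u. *)
Lemma forest_number_rec k u :
  forest_number k u.+1 =
  \sum_(j < u.+2) 'C(u.+1, j) * (k ^ j * forest_number j (u.+1 - j)).
Proof.
rewrite big_ord_recl /= subn0 /= mul0n !muln0 add0n addnC expnDn big_distrr /=.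
apply: eq_bigr => j _; rewrite /bump /= add1n subSS expnS.
have ju : j <= u by rewrite -ltnS.
suff E : 'C(u, j) * u.+1 ^ (u - j) = 'C(u.+1, j.+1) * forest_number j.+1 (u - j).
  rewrite [RHS]mulnCA -E -mulnA; congr (_ * _).
  by rewrite mulnA mulnC.
case E : (u - j) => [|w] /=.
  have -> : nat_of_ord j = u by apply/eqP; rewrite eqn_leq ju -subn_eq0 E.
  by rewrite !binn.
have -> : j.+1 + w.+1 = u.+1 by rewrite addSn -E subnKC.
by rewrite mulnA [_ * j.+1]mulnC -mul_bin_diag expnS mulnA [_ * u.+1]mulnC.
Qed.

(** Cayley's formula for rooted forests, by induction on the number of
    vertices that are not roots. *)
Lemma card_forests R U : [disjoint R & U]%B ->
  #|forests R U| = forest_number #|R| #|U|.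
Proof.
have [n] := ubnP #|U|; elim: n R U => // n IH R U; rewrite ltnS => Un dRU.
case: (set_0Vmem U) => [->|[x0 x0U]].
  rewrite cards0 /=; apply/eqP/cards1P; exists [ffun x => x].
  apply/finset.setP => f; rewrite inE; apply/forestsP/eqP.
    by move=> [H _ _]; apply/ffunP => x; rewrite ffunE H // inE.
  by move=> ->; split => x; rewrite ?inE // ffunE.
have [u Eu] : exists u, #|U| = u.+1.
  by exists #|U|.-1; rewrite prednK //; apply/card_gt0P; exists x0.
rewrite card_forests_rec // Eu forest_number_rec -Eu.
under [RHS]eq_bigr => j _ do rewrite mulnC -iter_addn_0.
rewrite -(big_subsets_card _ U (fun j => #|R| ^ j * forest_number j (#|U| - j))).
apply: eq_bigr => J; rewrite inE => JU; congr (_ * _).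
have EJ : #|U :\: J| = #|U| - #|J| by rewrite finset.cardsD (finset.setIidPr JU).
(* The induction hypothesis is unavailable when no vertex is a child of a root,
   but then there is no forest at all. *)
case: (set_0Vmem J) => [->|[x xJ]].
  rewrite cards0 subn0 finset.setD0 Eu /= mul0n; apply/eqP; rewrite cards_eq0 -finset.subset0.
  apply/fintype.subsetP => f /forestsP[_ _ /(_ _ x0U)[k]]; by rewrite inE.
rewrite -EJ; apply: IH.
  apply: leq_trans Un; rewrite EJ Eu ltnS leq_subLR.
  have J0 : 0 < #|J| by apply/card_gt0P; exists x.
  by rewrite -add1n leq_add2r.
by rewrite disjoint_subset; apply/fintype.subsetP => y yJ; rewrite !inE yJ.
Qed.

End Forests.

(** * Trees as parent maps *)

Lemma exists_least (P : nat -> Prop) : (exists k, P k) ->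
  exists k, P k /\ forall j, P j -> (k <= j)%N.
Proof.
move=> [k0 Pk0]; have ex : exists k, `[<P k>] by exists k0; apply/asboolP.
case: (ex_minnP ex) => k /asboolP Pk kmin; exists k; split => // j Pj.
exact/kmin/asboolP.
Qed.

Section ForestEdges.
Local Open Scope nat_scope.
Local Open Scope set_scope.
Variable T : finType.
Implicit Types (R U : {set T}) (f g : {ffun T -> T}).

Definition forest_edges U f : {set {set T}} :=
  [set ([set x; f x])%SET | x in U]%SET.

(** Take for d the number of steps to R.  Arguments about cycles of parent maps
    become inductions on this rank. *)
Lemma forest_rank R U f : [disjoint R & U]%B -> f \in forests R U ->
  exists d : T -> nat, forall x, x \in U -> d (f x) < d x.
Proof.
move=> dRU /forestsP[_ fU freach].
have least x : exists k, (exists j, iter j f x \in R) ->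
    iter k f x \in R /\ forall j, iter j f x \in R -> k <= j.
  have [/exists_least[k Hk]|no] := pselect (exists j, iter j f x \in R).
    by exists k.
  by exists 0.
have [d Hd] := choice least; exists d => x xU.
have [dR dmin] := Hd x (freach x xU).
case Ed : (d x) dR => [|k]; first by move=> /= xR; rewrite (disjointFr dRU xR) in xU.
rewrite iterSr ltnS => kR.
by have [_] := Hd (f x) (ex_intro _ k kR); apply.
Qed.

Lemma forest_edge_neq R U f x : [disjoint R & U]%B -> f \in forests R U ->
  x \in U -> x != f x.
Proof.
move=> dRU /(forest_rank dRU)[d Hd] xU.
by apply: contraTneq (Hd x xU) => <-; rewrite ltnn.
Qed.

Lemma set2_eq_cases (x y u v : T) : x != y ->
  ([set x; y] = [set u; v])%SET -> (x = u /\ y = v) \/ (x = v /\ y = u).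
Proof.
move=> xy E.
have /set2P[xu|xv] : (x \in [set u; v])%SET by rewrite -E !inE eqxx.
  left; split=> //; have /set2P[yu|//] : (y \in [set u; v])%SET by rewrite -E !inE eqxx orbT.
  by rewrite xu yu eqxx in xy.
right; split=> //; have /set2P[//|yv] : (y \in [set u; v])%SET by rewrite -E !inE eqxx orbT.
by rewrite xv yv eqxx in xy.
Qed.

Lemma card_forest_edges R U f : [disjoint R & U]%B -> f \in forests R U ->
  #|forest_edges U f| = #|U|.
Proof.
move=> dRU fF; have [d Hd] := forest_rank dRU fF.
apply: card_in_imset => x y xU yU /set2_eq_cases.
case; [exact: forest_edge_neq fF xU|by case|move=> [xfy fxy]].
have := Hd x xU; rewrite fxy => /(ltn_trans (Hd y yU)).
by rewrite -xfy ltnn.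
Qed.

(** An edge {x, f x} of the forest of g either joins x to its g-parent, which
    must be f x, or f x to its g-parent x; the latter is excluded by induction
    on the rank, as f and g agree on f x. *)
Lemma forest_edges_inj R U : [disjoint R & U]%B ->
  {in forests R U &, injective (forest_edges U)}.
Proof.
move=> dRU f g fF gF E; have [d Hd] := forest_rank dRU fF.
have fg k x : d x < k -> x \in U -> f x = g x.
  elim: k x => // k IH x dxk xU.
  have /imsetP[y yU] : [set x; f x]%SET \in forest_edges U g.
    by rewrite -E; apply: imset_f.
  move=> /set2_eq_cases[|[-> //]|[xgy fxy]]; first exact: forest_edge_neq fF xU.
  have dlt := Hd x xU; rewrite fxy in dlt.
  have := Hd y yU; rewrite (IH y) //; last exact: leq_trans dlt _.
  by rewrite -xgy => /(ltn_trans dlt); rewrite ltnn.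
case/forestsP: fF => f1 _ _; case/forestsP: gF => g1 _ _.
apply/ffunP => x; case: (boolP (x \in U)) => xU; last by rewrite f1 // g1.
exact: fg (ltnSn _) xU.
Qed.

End ForestEdges.

Section Trees.
Local Open Scope nat_scope.
Local Open Scope set_scope.
Variable V : nat.
Implicit Types (S : {set 'I_V}) (E : {set {set 'I_V}}) (f : {ffun 'I_V -> 'I_V}).
Variable r : 'I_V.

(** These encode the trees with vertex set S, each oriented towards r. *)
Definition parent_maps S : {set {ffun 'I_V -> 'I_V}} :=
  forests [set r]%SET (S :\ r)%SET.

Definition tree_edges S f := forest_edges (S :\ r)%SET f.

Lemma disjoint_root S : [disjoint [set r]%SET & (S :\ r)%SET]%B.
Proof.
by rewrite disjoint_subset; apply/fintype.subsetP => y; rewrite !inE => /eqP ->; rewrite eqxx.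
Qed.

Lemma adj_sym (A : subgraph V) : symmetric (adj A).
Proof. by move=> x y; rewrite /adj eq_sym finset.setUC. Qed.

Lemma parent_in S f x : r \in S -> f \in parent_maps S -> x \in S :\ r -> f x \in S.
Proof.
move=> rS /forestsP[_ fU _] /fU; rewrite !inE => /orP[/eqP -> //|/andP[]//].
Qed.

Lemma adj_parent S f x : f \in parent_maps S -> x \in S :\ r ->
  adj (S, tree_edges S f) x (f x).
Proof.
move=> fF xU; rewrite /adj (forest_edge_neq (disjoint_root S) fF xU) /=.
exact: imset_f.
Qed.

Lemma adj_tree S f x y : adj (S, tree_edges S f) x y ->
  x \in S :\ r /\ y = f x \/ y \in S :\ r /\ x = f y.
Proof.
move=> /andP[xy /imsetP[u uU] /(set2_eq_cases xy)[] [E1 E2]]; last by right; rewrite E1 E2.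
by left; rewrite E1 E2.
Qed.

(** Acyclicity: a vertex of a cycle that has maximal rank can only be adjacent,
    within the cycle, to its parent, but it has two distinct neighbours
    there. *)
Lemma parent_map_tree S f : r \in S -> f \in parent_maps S ->
  is_tree (S, tree_edges S f).
Proof.
move=> rS fF; have dR := disjoint_root S.
have [d Hd] := forest_rank dR fF.
rewrite /is_tree /is_connected_subgraph -!andbA; apply/and4P; split.
- by apply/set0Pn; exists r.
- apply/forall_inP => e /imsetP[x xU ->].
  rewrite cards2 (forest_edge_neq dR fF xU) /=.
  apply/fintype.subsetP => y /set2P[] ->; last exact: parent_in fF xU.
  by case/setD1P: xU.
- have toroot x : x \in S -> connect (adj (S, tree_edges S f)) x r.
    have [k] := ubnP (d x); elim: k x => // k IH x dxk xS.
    have [->|xr] := eqVneq x r; first exact: connect0.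
    have xU : x \in S :\ r by rewrite !inE xr.
    apply: connect_trans (connect1 (adj_parent fF xU)) _.
    apply: IH; last exact: parent_in fF xU.
    exact: leq_trans (Hd x xU) _.
  apply/forall_inP => x xS; apply/forall_inP => y yS.
  apply: connect_trans (toroot x xS) _.
  by rewrite (sym_connect_sym (adj_sym _)); exact: toroot.
- apply/asboolP => c sc uc.
  have [x0 x0c] : exists x0, x0 \in c by case: c sc {uc} => // x0 c; exists x0; rewrite inE eqxx.
  case: (arg_maxnP (P := mem c) d x0c) => x xc xmax.
  have nb w : w \in c -> adj (S, tree_edges S f) x w -> w = f x.
    move=> wc /adj_tree[[_ //]|[wU xw]].
    by have := xmax w wc; rewrite xw => /(leq_trans (Hd w wU)); rewrite ltnn.
  case: (rot_to xc) => i s Es.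
  move: uc; rewrite -(rot_ucycle i) Es /= => /andP[/= pth /andP[xs us]].
  have ss : size s > 1 by rewrite -ltnS -[(size s).+1]/(size (x :: s)) -Es size_rot.
  have mems w : w \in s -> w \in c by move=> ws; rewrite -(mem_rot i) Es inE ws orbT.
  case: s => [|y s] in Es pth xs us ss mems * => //.
  case/lastP: s => [|s z] in Es pth xs us ss mems * => //.
  move: pth; rewrite /= rcons_path last_rcons /= => /and3P[axy _ azx].
  have Ey : y = f x by apply: nb axy; apply: mems; rewrite inE eqxx.
  have Ez : z = f x.
    by apply: nb; [apply: mems; rewrite inE mem_rcons inE eqxx orbT|rewrite adj_sym].
  by move: us; rewrite /= mem_rcons inE Ey Ez eqxx.
Qed.

(** The spanning tree: each vertex is mapped to a neighbour that is closer to
    the root. *)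
Lemma connected_parent_map S E : r \in S -> is_connected_subgraph (S, E) ->
  exists2 f, f \in parent_maps S & tree_edges S f \subset E.
Proof.
move=> rS /andP[/andP[_ /forall_inP /= sub] /forall_inP /= con].
pose toroot x p := path (adj (S, E)) x p /\ last x p = r.
have least x : exists k, x \in S -> (exists2 p, toroot x p & size p = k) /\
    forall j, (exists2 p, toroot x p & size p = j) -> k <= j.
  have [xS|xS] := boolP (x \in S); last by exists 0.
  have /connectP[p pp lp] : connect (adj (S, E)) x r by move: (con x xS) => /forall_inP; apply.
  have [|k Hk] := @exists_least (fun k => exists2 p, toroot x p & size p = k).
    by exists (size p), p.
  by exists k.
have [d Hd] := choice least.
have closer x : exists y, x \in S :\ r -> [/\ y \in S, adj (S, E) x y & d y < d x].
  have [xU|xU] := boolP (x \in S :\ r); last by exists x.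
  case/setD1P: xU => xr xS.
  have [[p [pp lp] sp] _] := Hd x xS.
  case: p => [|y p] in pp lp sp *; first by rewrite /= in lp; rewrite lp eqxx in xr.
  move: pp => /= /andP[axy pp]; exists y => _.
  have yS : y \in S.
    case/andP: axy => _ /sub /andP[_ /fintype.subsetP]; apply; by rewrite !inE eqxx orbT.
  split => //; have [_ dmin] := Hd y yS.
  by rewrite -sp /= ltnS; apply: dmin; exists p.
have [par Hpar] := choice closer.
exists [ffun x => if x \in S :\ r then par x else x].
  set f := [ffun _ => _]; have fE x : x \in S :\ r -> f x = par x by rewrite ffunE => ->.
  apply/forestsP; split.
  - by move=> x xU; rewrite ffunE (negPf xU).
  - move=> x xU; rewrite fE //; have [pS _ _] := Hpar x xU.
    by rewrite !inE pS andbT orbN.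
  - move=> x xU; have xS : x \in S by case/setD1P: xU.
    have [k] := ubnP (d x); elim: k x xS {xU} => // k IH x xS dxk.
    have [->|xr] := eqVneq x r; first by exists 0; rewrite /= inE.
    have xU : x \in S :\ r by rewrite !inE xr.
    have [pS _ dlt] := Hpar x xU.
    have [|j Hj] := IH (par x) pS; first exact: leq_trans dlt _.
    by exists j.+1; rewrite iterSr fE.
apply/fintype.subsetP => e /imsetP[x xU ->]; rewrite ffunE xU.
by have [_ /andP[]] := Hpar x xU.
Qed.

(** An edge outside of a spanning tree closes a cycle with the path that joins
    its ends in the tree. *)
Lemma acyclic_tree_edges S E f : r \in S -> is_subgraph (S, E) ->
  graph_acyclic (S, E) -> f \in parent_maps S -> tree_edges S f \subset E ->
  E = tree_edges S f.
Proof.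
move=> rS /andP[_ /forall_inP /= sub] acyc fF fE.
apply/eqP; rewrite finset.eqEsubset fE andbT; apply/fintype.subsetP => e eE.
have /andP[/cards2P[x [y [xy Ee]]] eS] := sub e eE.
apply: contraT => eF.
have [xS yS] : x \in S /\ y \in S.
  by split; apply: (fintype.subsetP eS); rewrite Ee !inE eqxx ?orbT.
have /andP[/andP[_ /forall_inP /= con] _] := parent_map_tree rS fF.
have /connectP[p pp lp] : connect (adj (S, tree_edges S f)) x y.
  by move: (con x xS) => /forall_inP; apply.
case/shortenP: pp lp => q pq uq _ lq.
case: (acyc (x :: q)); last first.
  rewrite /ucycle uq andbT /= rcons_path -lq.
  apply/andP; split; last by rewrite /adj eq_sym xy finset.setUC -Ee.
  apply: sub_path pq => u v /andP[uv /(fintype.subsetP fE) uvE].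
  by rewrite /adj uv.
case: q => [|z [|z' q]] in pq uq lq * => //.
  by rewrite /= in lq; rewrite lq eqxx in xy.
move: pq lq => /= /andP[/andP[_ xz] _] lq.
by rewrite Ee lq xz in eF.
Qed.

Lemma tree_setE S : r \in S ->
  [set E | is_tree (S, E)]%SET = [set tree_edges S f | f in parent_maps S]%SET.
Proof.
move=> rS; apply/finset.setP => E; rewrite inE; apply/idP/imsetP.
  move=> /andP[conE /asboolP acyc]; have [f fF fE] := connected_parent_map rS conE.
  exists f => //; apply: acyclic_tree_edges acyc fF fE => //.
  by case/andP: conE.
by move=> [f fF ->]; exact: parent_map_tree.
Qed.

End Trees.

(** * The one-point functions as finite sums *)

Section Sums.
Local Open Scope set_scope.
Local Open Scope ring_scope.
Variable F : realType.

Lemma sum_expr_subsets (T : finType) (P : {set T}) (y : F) :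
  \sum_(D in powerset P) y ^+ #|D| = (1 + y) ^+ #|P|.
Proof.
rewrite (big_subsets_card _ P (fun k => y ^+ k)) exprDn.
by apply: eq_bigr => j _; rewrite iter_addr_0 expr1n mul1r.
Qed.

Lemma ler_sum_subset (I : finType) (A B : {set I}) (h : I -> F) :
  A \subset B -> (forall i, i \in B -> 0 <= h i) ->
  \sum_(i in A) h i <= \sum_(i in B) h i.
Proof.
move=> /fintype.subsetP AB h0; rewrite big_mkcond [leRHS]big_mkcond /=.
apply: ler_sum => i _; case: ifP => [/AB ->//|_].
by case: ifP => // /h0.
Qed.

Variable n : nat.
Local Notation r := (@ord0 n).
Implicit Types S : {set 'I_n.+1}.

(** Sets containing the root correspond to subsets of the n other vertices. *)
Lemma sum_rooted_sets (h : nat -> F) :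
  \sum_(S : {set 'I_n.+1} | r \in S) h #|S :\ r| =
  \sum_(m < n.+1) h m *+ 'C(n, m).
Proof.
rewrite (reindex_onto (fun U => r |: U)%SET (fun S => S :\ r)%SET) /=; last first.
  by move=> S rS; rewrite finset.setD1K.
have E (U : {set 'I_n.+1}) : (r \in r |: U) && ((r |: U) :\ r == U) =
    (U \in powerset [set~ r]%SET).
  rewrite !inE eqxx /= finset.subsetC finset.sub1set inE; apply/eqP/idP => [<-|rU].
    by rewrite !inE eqxx.
  by rewrite finset.setU1K.
have Er : #|[set~ r]%SET| = n by rewrite finset.cardsC1 card_ord.
have := big_subsets_card (+%R : Monoid.com_law (0 : F)) [set~ r]%SET h.
rewrite Er => H.
under [RHS]eq_bigr => m _ do rewrite -iter_addr_0.
rewrite -H (eq_bigl _ _ E); apply: eq_bigr => U; rewrite -E => /andP[_ /eqP ->].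
by [].
Qed.

Lemma contains0E S E : contains0 (S, E) = (r \in S).
Proof.
apply/exists_inP/idP => [[x xS /eqP x0]|rS]; last by exists r.
by have -> : r = x by apply: val_inj.
Qed.

Lemma card_parent_maps S : #|parent_maps r S| = (#|S :\ r|.+1 ^ #|S :\ r|.-1)%N.
Proof.
rewrite card_forests ?disjoint_root // cards1.
by case: #|_| => [|m] //=; rewrite mul1n add1n.
Qed.

Lemma sum_trees S (z : F) : r \in S ->
  \sum_(E | is_tree (S, E)) z ^+ #|E| =
  (z ^+ #|S :\ r|) *+ (#|S :\ r|.+1 ^ #|S :\ r|.-1)%N.
Proof.
move=> rS; rewrite -card_parent_maps -sumr_const.
transitivity (\sum_(E in [set tree_edges r S f | f in parent_maps r S]%SET) z ^+ #|E|).
  by apply: eq_bigl => E; rewrite -tree_setE // inE.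
rewrite big_imset; last exact/forest_edges_inj/disjoint_root.
apply: eq_bigr => f fF; congr (_ ^+ _).
exact: card_forest_edges (disjoint_root r S) fF.
Qed.

Lemma Gt_sum (p : F) :
  Gt n.+1 p = \sum_(m < n.+1)
    (p / (expR 1 * n.+1%:R)) ^+ m *+ (m.+1 ^ m.-1) *+ 'C(n, m).
Proof.
rewrite /Gt; set z := p / _.
rewrite -(sum_rooted_sets (fun m => z ^+ m *+ (m.+1 ^ m.-1))).
under [RHS]eq_bigr => S rS do rewrite -(sum_trees z rS).
rewrite pair_big_dep /=; apply: eq_bigl => -[S E] /=.
by rewrite contains0E andbC.
Qed.

(** A connected graph that is not a tree is a spanning tree together with a
    nonempty set of further pairs of vertices.  The choice of the spanning tree
    is not unique, whence an inequality. *)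
Lemma sum_nontrees S (y : F) : r \in S -> 0 <= y ->
  \sum_(E | is_connected_subgraph (S, E) && ~~ is_tree (S, E)) y ^+ #|E| <=
  (y ^+ #|S :\ r| * ((1 + y) ^+ 'C(#|S :\ r|.+1, 2) - 1))
     *+ (#|S :\ r|.+1 ^ #|S :\ r|.-1)%N.
Proof.
move=> rS y0; rewrite -card_parent_maps -sumr_const.
pose bad (E : {set {set 'I_n.+1}}) := is_connected_subgraph (S, E) && ~~ is_tree (S, E).
rewrite (eq_bigl bad) //.
pose over (f : {ffun 'I_n.+1 -> 'I_n.+1}) (E : {set {set 'I_n.+1}}) := tree_edges r S f \subset E.
apply: (@le_trans _ _ (\sum_(E | bad E) \sum_(f in parent_maps r S | over f E) y ^+ #|E|)).
  apply: ler_sum => E /andP[conE _].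
  have [f fF fE] := connected_parent_map rS conE.
  rewrite (bigD1 f) /=; last by rewrite fF.
  by rewrite lerDl sumr_ge0 // => *; exact: exprn_ge0.
rewrite (exchange_big_dep (mem (parent_maps r S))) /=; last by move=> ? ? _ /andP[].
apply: ler_sum => f fF.
set m := #|S :\ r|.
have cf : #|tree_edges r S f| = m by exact: card_forest_edges (disjoint_root r S) fF.
pose P := [set e : {set 'I_n.+1} | e \subset S & #|e| == 2%N]%SET.
have cP : #|P| = 'C(m.+1, 2) by rewrite cards_draws (cardsD1 r) rS add1n.
rewrite -cP -sum_expr_subsets [X in _ * (X - 1)](bigD1 finset.set0) /=;
  last by rewrite powersetE finset.sub0set.
rewrite cards0 expr0 addrAC subrr add0r mulr_sumr.
pose B := [set E | bad E && over f E]%SET.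
pose ext E := (E :\: tree_edges r S f)%SET.
have BE E : E \in B -> [/\ bad E & tree_edges r S f \subset E] by rewrite inE => /andP[].
rewrite [leLHS](_ : _ = \sum_(E in B) y ^+ m * y ^+ #|ext E|); last first.
  apply: eq_big => [E|E /andP[/andP[_ _] /andP[_ fE]]]; first by rewrite fF [in RHS]inE.
  by rewrite -exprD -cf -(cardsID (tree_edges r S f) E) (finset.setIidPr fE).
have inj : {in B &, injective ext}.
  move=> E1 E2 /BE[_ s1] /BE[_ s2] E12.
  rewrite -(finset.setID E1 (tree_edges r S f)) -[RHS](finset.setID E2 (tree_edges r S f)).
  by rewrite -/(ext E1) E12 (finset.setIidPr s1) (finset.setIidPr s2).
rewrite -(big_imset (fun D : {set {set 'I_n.+1}} => y ^+ m * y ^+ #|D|) inj) /=.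
rewrite [leRHS](_ : _ = \sum_(D in powerset P :\ finset.set0) y ^+ m * y ^+ #|D|); last first.
  by apply: eq_bigl => D; rewrite !inE andbC.
apply: ler_sum_subset; last by move=> D _; rewrite mulr_ge0 // exprn_ge0.
apply/fintype.subsetP => D /imsetP[E /BE[/andP[conE ntree] fE] ->].
rewrite !inE; apply/andP; split.
  apply: contra ntree; rewrite finset.setD_eq0 => Ef.
  have -> : E = tree_edges r S f by apply/eqP; rewrite finset.eqEsubset Ef fE.
  exact: parent_map_tree.
apply/fintype.subsetP => e; rewrite !inE => /andP[_ eE].
by case/andP: conE => /andP[_ /forall_inP /(_ e eE)]; rewrite andbC.
Qed.

Lemma Ga_sub_Gt (p : F) :
  `|Ga n.+1 p - Gt n.+1 p| <= \sum_(m < n.+1)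
    (`|p| / (expR 1 * n.+1%:R)) ^+ m
     * ((1 + `|p| / (expR 1 * n.+1%:R)) ^+ 'C(m.+1, 2) - 1)
     *+ (m.+1 ^ m.-1) *+ 'C(n, m).
Proof.
rewrite /Ga /Gt; set z := p / _; set y := `|p| / _.
have yE : y = `|z|.
  by rewrite normrM normfV (@ger0_norm _ (_ * _)) // mulr_ge0 // expR_ge0.
have y0 : 0 <= y by rewrite yE.
rewrite (bigID (fun A => is_tree A)) /=.
rewrite (eq_bigl (fun T => is_tree T && contains0 T)); last first.
  by move=> A /=; rewrite /is_tree; case: (is_connected_subgraph A);
  case: (contains0 A) => /=; rewrite ?andbF ?andbT.
rewrite addrAC subrr add0r.
rewrite -(sum_rooted_sets (fun m => y ^+ m * ((1 + y) ^+ 'C(m.+1, 2) - 1) *+ (m.+1 ^ m.-1))).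
apply: le_trans (ler_norm_sum _ _ _) _.
apply: le_trans (ler_sum _ (fun S rS => sum_nontrees rS y0)).
rewrite pair_big_dep /= le_eqVlt; apply/orP; left; apply/eqP.
apply: eq_big => [[S E] /=|[S E] _]; last by rewrite normrX -yE.
by rewrite contains0E; case: (is_connected_subgraph _) => //=; rewrite andbC.
Qed.

End Sums.

(** * Abel polynomials *)

Section Abel.
Variable F : realType.
Implicit Types (x y z h : F) (m M N : nat).

(** Abel's polynomials y (y + m)^(m - 1) / m!, again with a separate case for
    the exponent -1 at m = 0. *)
Definition abel_poly m : {poly F} :=
  if m is m'.+1 then m`!%:R^-1 *: ('X * ('X + m%:R%:P) ^+ m') else 1.

Definition abel m y : F := (abel_poly m).[y].

Lemma abel0 y : abel 0 y = 1.
Proof. by rewrite /abel hornerC. Qed.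

Lemma abelS m y : abel m.+1 y = y * (y + m.+1%:R) ^+ m / m.+1`!%:R.
Proof.
by rewrite /abel hornerZ hornerM horner_exp hornerD hornerX hornerC mulrC.
Qed.

Lemma abel_ge0 m y : 0 <= y -> 0 <= abel m y.
Proof.
case: m => [|m] y0; first by rewrite abel0.
by rewrite abelS divr_ge0 ?ler0n ?mulr_ge0 ?exprn_ge0 ?addr_ge0 ?ler0n.
Qed.

Lemma fact_neq0 m : m`!%:R != 0 :> F.
Proof. by rewrite pnatr_eq0 -lt0n fact_gt0. Qed.

(** With this normalization, differentiation lowers the index and translates
    the argument by 1; this characterizes the sequence together with the
    values at 0, and is what makes it of binomial type. *)
Lemma deriv_abel_poly m : (abel_poly m.+1)^`() = abel_poly m \Po ('X + 1%:P).
Proof.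
case: m => [|m]; rewrite /abel_poly.
  by rewrite expr0 mulr1 invr1 scale1r derivX comp_polyC.
rewrite comp_polyZ comp_polyM (rmorphXn (comp_poly _)) /= comp_polyD comp_polyX comp_polyC.
rewrite derivZ derivM derivX mul1r deriv_exp derivD derivX derivC addr0 mul1r.
have -> : 'X + 1%:P + m.+1%:R%:P = 'X + m.+2%:R%:P :> {poly F}.
  by rewrite -addrA -polyCD nat1r.
set Q := 'X + _%:P.
have -> : Q ^+ m.+1 + 'X * (Q ^+ m.+1.-1 *+ m.+1) =
    m.+2%:R *: (('X + 1%:P) * Q ^+ m) :> {poly F}.
  rewrite /= exprS mulrnAr -mulrnAl -mulrDl scalerAl; congr (_ * _).
  by rewrite scaler_nat mulrnDl -polyCMn [in RHS]mulrS /Q addrAC.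
rewrite scalerA; congr (_ *: _).
by rewrite (factS m.+1) natrM invfM mulrAC mulVf ?mul1r // pnatr_eq0.
Qed.

Lemma deriv_inj (p q : {poly F}) : p^`() = q^`() -> p.[0] = q.[0] -> p = q.
Proof.
move=> dpq; rewrite !horner_coef0 => pq0; apply/polyP => -[//|i].
have := congr1 (fun p : {poly F} => p`_i) dpq; rewrite /= !coef_deriv.
by move/eqP; rewrite -subr_eq0 -mulrnBl mulrn_eq0 /= subr_eq0 => /eqP.
Qed.

(** Abel's binomial identity.  By induction both sides have the same
    derivative in 'X, and both take the value [abel m z] at 0. *)
Lemma abel_poly_conv m z :
  \sum_(k < m.+1) abel_poly k * (abel (m - k) z)%:P = abel_poly m \Po ('X + z%:P).
Proof.
elim: m => [|m IH].
  by rewrite big_ord1 abel0 comp_polyC mulr1.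
apply: deriv_inj.
  rewrite deriv_comp derivD derivX derivC addr0 mulr1 deriv_abel_poly.
  rewrite -comp_polyA comp_polyD comp_polyX comp_polyC addrAC.
  have -> : 'X + 1%:P + z%:P = ('X + z%:P) \Po ('X + 1%:P) :> {poly F}.
    by rewrite comp_polyD comp_polyX comp_polyC.
  rewrite comp_polyA -IH (raddf_sum (comp_poly _)) raddf_sum big_ord_recl /=.
  rewrite derivM derivC mulr0 addr0 derivC mul0r add0r.
  apply: eq_bigr => k _; rewrite derivM derivC mulr0 addr0 /bump /= add1n subSS.
  by rewrite deriv_abel_poly comp_polyM comp_polyC.
rewrite horner_comp hornerD hornerX hornerC add0r horner_sum big_ord_recl /=.
rewrite hornerM !hornerC mul1r subn0 big1 ?addr0 // => k _.
have e0 : (abel_poly k.+1).[0] = 0 by have := abelS k 0; rewrite !mul0r.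
by rewrite hornerM [X in X * _]e0 mul0r.
Qed.

Lemma abelD m y z : \sum_(k < m.+1) abel k y * abel (m - k) z = abel m (y + z).
Proof.
have := congr1 (fun p => p.[y]) (abel_poly_conv m z).
rewrite /= horner_comp hornerD hornerX hornerC horner_sum.
move=> E; transitivity ((abel_poly m).[y + z]) => //; rewrite -E.
by apply: eq_bigr => k _; rewrite hornerM hornerC.
Qed.

Definition abel_psum M x y := \sum_(m < M) abel m y * x ^+ m.

(** The partial sums are values of polynomials in x, so that their products are
    expanded by multiplication of polynomials. *)
Definition abel_trunc M y := \poly_(m < M) abel m y.

Lemma abel_psum_horner M x y : abel_psum M x y = (abel_trunc M y).[x].
Proof. by rewrite horner_poly. Qed.

Lemma coef_abel_truncM M N y z i :
  (abel_trunc M y * abel_trunc N z)`_i =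
  \sum_(k < i.+1) (if (k < M)%N then abel k y else 0) *
                  (if (i - k < N)%N then abel (i - k) z else 0).
Proof. by rewrite coefM; apply: eq_bigr => k _; rewrite !coef_poly. Qed.

Lemma abel_psumM M N x y z : abel_psum M x y * abel_psum N x z =
  \sum_(i < M + N) (abel_trunc M y * abel_trunc N z)`_i * x ^+ i.
Proof.
rewrite !abel_psum_horner -hornerM; apply: horner_coef_wide.
apply: leq_trans (size_polyMleq _ _) _; apply: leq_trans (leq_pred _) _.
by apply: leq_add; exact: size_poly.
Qed.

(** The coefficients of the product of two truncated series are bounded by
    those of the product of the full series, and those below both truncations
    agree with them; together with [abel_psumD_le] this makes the partial sums
    multiplicative up to truncation. *)
Lemma abel_psumD_ge M N x y z : 0 <= x -> 0 <= y -> 0 <= z ->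
  abel_psum M x y * abel_psum N x z <= abel_psum (M + N) x (y + z).
Proof.
move=> x0 y0 z0; rewrite abel_psumM; apply: ler_sum => i _.
rewrite ler_wpM2r ?exprn_ge0 // coef_abel_truncM -abelD.
apply: ler_sum => k _; have yk := abel_ge0 k y0; have zk := abel_ge0 (i - k) z0.
by case: ifP => _; case: ifP => _; rewrite ?mul0r ?mulr0 ?mulr_ge0.
Qed.

Lemma abel_psumD_le M x y z : 0 <= x -> 0 <= y -> 0 <= z ->
  abel_psum M x (y + z) <= abel_psum M x y * abel_psum M x z.
Proof.
move=> x0 y0 z0; rewrite abel_psumM big_split_ord /= -[leLHS]addr0.
apply: lerD; last first.
  apply: sumr_ge0 => i _; rewrite mulr_ge0 ?exprn_ge0 // coef_abel_truncM.
  apply: sumr_ge0 => k _; apply: mulr_ge0; case: ifP => // _; exact: abel_ge0.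
apply: ler_sum => i _; rewrite ler_wpM2r ?exprn_ge0 // coef_abel_truncM -abelD.
rewrite le_eqVlt; apply/orP; left; apply/eqP; apply: eq_bigr => k _.
have kM : (k < M)%N by apply: leq_ltn_trans (ltn_ord i); rewrite -ltnS.
by rewrite kM (leq_ltn_trans (leq_subr _ _) (ltn_ord i)).
Qed.

Lemma abel_psum_ge0 M x y : 0 <= x -> 0 <= y -> 0 <= abel_psum M x y.
Proof.
by move=> x0 y0; apply: sumr_ge0 => i _; rewrite mulr_ge0 ?exprn_ge0 // abel_ge0.
Qed.

Lemma abel_psum_arg0 M x : abel_psum M.+1 x 0 = 1.
Proof.
rewrite /abel_psum big_ord_recl /= abel0 expr0 mulr1 big1 ?addr0 // => i _.
by rewrite abelS !mul0r.
Qed.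

Lemma abel_psum_le_exp M N x y : 0 <= x -> 0 <= y ->
  abel_psum M.+1 x (y *+ N) <= abel_psum M.+1 x y ^+ N.
Proof.
move=> x0 y0; elim: N => [|N IH]; first by rewrite mulr0n abel_psum_arg0.
rewrite mulrS exprS; apply: le_trans (abel_psumD_le _ _ _ _) _ => //.
  by rewrite mulrn_wge0.
by apply: ler_wpM2l => //; exact: abel_psum_ge0.
Qed.

Lemma abel_psum_exp_le M N x y : 0 <= x -> 0 <= y ->
  abel_psum M x y ^+ N <= abel_psum (M * N).+1 x (y *+ N).
Proof.
move=> x0 y0; elim: N => [|N IH]; first by rewrite muln0 mulr0n abel_psum_arg0.
rewrite mulrS exprS mulnS -addnS; apply: le_trans (abel_psumD_ge _ _ _ _ _) => //.
  by apply: ler_wpM2l => //; exact: abel_psum_ge0.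
by rewrite mulrn_wge0.
Qed.

End Abel.

(** * The tree series and its functional equation *)

Section TreeSeries.
Variable F : realType.
Implicit Types (x y z h t : F) (m M N : nat).

Lemma abel1 m : abel m (1 : F) = (m.+1 ^ m.-1)%:R / m`!%:R.
Proof.
case: m => [|m]; first by rewrite abel0 exp1n divr1.
by rewrite abelS mul1r nat1r natrX.
Qed.

(** The values at 1 are the coefficients of the series of the theorem. *)
Lemma abel1_exp m : abel m (1 : F) = m.+1%:R ^+ m / m.+1`!%:R.
Proof.
rewrite abel1; case: m => [|m]; first by rewrite expr0 exp1n.
by rewrite [m.+1.-1]/= natrX [in RHS]exprS [in RHS]factS [in RHS]natrM invfM
  mulrACA mulfV ?mul1r ?pnatr_eq0.
Qed.

(** The slope between 0 and h of the partial sum of order [M.+1] as a function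
    of y. *)
Definition abel_slope M x h :=
  \sum_(m < M) (h + m.+1%:R) ^+ m / m.+1`!%:R * x ^+ m.+1.

Lemma abel_psum_slope M x h : abel_psum M.+1 x h = 1 + h * abel_slope M x h.
Proof.
rewrite /abel_psum big_ord_recl /= abel0 expr0 mulr1 mulr_sumr; congr (_ + _).
by apply: eq_bigr => m _; rewrite abelS !mulrA.
Qed.

(** The derivative at 0 of the partial sums brings back their values at 1; it
    is this relation that turns multiplicativity into a functional equation. *)
Lemma abel_slope0 M x : abel_slope M x 0 = x * abel_psum M x 1.
Proof.
rewrite /abel_psum mulr_sumr; apply: eq_bigr => m _.
by rewrite add0r abel1_exp exprS mulrCA.
Qed.

Lemma le_abel_slope M x h : 0 <= x -> 0 <= h -> abel_slope M x 0 <= abel_slope M x h.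
Proof.
move=> x0 h0; apply: ler_sum => m _.
rewrite ler_wpM2r ?exprn_ge0 // ler_wpM2r ?invr_ge0 ?ler0n //.
by apply: lerXn2r; rewrite ?nnegrE ?addr_ge0 ?ler0n // lerD2r.
Qed.

Lemma abel_slope_ge0 M x h : 0 <= x -> 0 <= h -> 0 <= abel_slope M x h.
Proof.
move=> x0 h0; apply: sumr_ge0 => m _.
by rewrite mulr_ge0 ?divr_ge0 ?exprn_ge0 ?addr_ge0 ?ler0n.
Qed.

Lemma cvg_abel_slope M x :
  abel_slope M x (harmonic N) @[N --> \oo] --> abel_slope M x 0.
Proof.
pose P : {poly F} :=
  \sum_(m < M) (m.+1`!%:R^-1 * x ^+ m.+1) *: ('X + m.+1%:R%:P) ^+ m.
have PE h : abel_slope M x h = P.[h].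
  rewrite horner_sum; apply: eq_bigr => m _.
  by rewrite hornerZ horner_exp hornerD hornerX hornerC mulrC mulrA mulrAC [_ * x ^+ _]mulrC mulrC.
rewrite PE; under eq_fun do rewrite PE.
apply: (cvg_comp _ _ cvg_harmonic); exact: continuous_horner.
Qed.

(** The partial sum at 1 is at most the N-th power of the one at 1/N, that is
    (1 + slope / N)^N, which is at most exp slope; let N tend to infinity. *)
Lemma abel_psumS_le_expR M x : 0 <= x ->
  abel_psum M.+1 x 1 <= expR (x * abel_psum M x 1).
Proof.
move=> x0; rewrite -abel_slope0.
have cvgh : expR (abel_slope M x (harmonic N)) @[N --> \oo] -->
    expR (abel_slope M x 0).
  by apply: (cvg_comp _ _ (@cvg_abel_slope M x)); exact: continuous_expR.
apply: (cvgr_to_ge cvgh).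
near=> N; pose h : F := N.+1%:R^-1.
have h0 : 0 <= h by rewrite invr_ge0 ler0n.
have hN : h *+ N.+1 = 1 by rewrite -mulr_natr mulVf // pnatr_eq0.
rewrite -{1}hN; apply: le_trans (abel_psum_le_exp _ _ x0 h0) _.
rewrite -/h /= abel_psum_slope -/h.
apply: (@le_trans _ _ (expR (h * abel_slope M x h) ^+ N.+1)).
  apply: lerXn2r; rewrite ?nnegrE ?expR_ge0 ?expR_ge1Dx //.
  by rewrite addr_ge0 // mulr_ge0 // abel_slope_ge0.
by rewrite -expRM_natl mulrA mulr_natl hN mul1r.
Unshelve. all: end_near. Qed.

Lemma expR_frac_le t : 0 <= t -> expR (t / (1 + t)) <= 1 + t.
Proof.
move=> t0; have t1 : 0 < 1 + t by rewrite ltr_pwDl.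
rewrite -[leLHS]invrK -expRN -[leRHS]invrK lef_pV2 ?posrE ?invr_gt0 ?expR_gt0 //.
apply: le_trans (expR_ge1Dx _).
by rewrite -[X in _ <= X - _](divff (lt0r_neq0 t1)) -mulrBl addrK mul1r.
Qed.

Section Converge.
Variable x : F.
Hypotheses (x0 : 0 <= x) (x1 : x <= expR (-1)).

(** If x u <= 1 then x exp (x u) <= exp (-1) exp 1 = 1. *)
Lemma abel_psum_bound M : x * abel_psum M x 1 <= 1.
Proof.
elim: M => [|M IH]; first by rewrite /abel_psum big_ord0 mulr0.
apply: le_trans (ler_wpM2l x0 (abel_psumS_le_expR M x0)) _.
apply: (@le_trans _ _ (expR (-1) * expR 1)); last by rewrite -expRD addNr expR0.
by apply: ler_pM; rewrite ?expR_ge0 // ler_expR.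
Qed.

Lemma abel_psum_nondecreasing : nondecreasing_seq (fun M => abel_psum M x 1).
Proof.
apply/nondecreasing_seqP => M; rewrite /abel_psum big_ord_recr /= lerDl.
by rewrite mulr_ge0 ?exprn_ge0 // abel_ge0.
Qed.

Lemma is_cvg_abel_psum : cvgn (fun M => abel_psum M x 1).
Proof.
apply: nondecreasing_is_cvgn; first exact: abel_psum_nondecreasing.
exists (expR 1) => _ [M _ <-].
apply: le_trans (abel_psum_nondecreasing (leqnSn M)) _.
apply: le_trans (abel_psumS_le_expR M x0) _.
by rewrite ler_expR; exact: abel_psum_bound.
Qed.

Definition abel_sum := limn (fun M => abel_psum M x 1).

Lemma abel_sum_bound : x * abel_sum <= 1.
Proof.
have cvgx : x * abel_psum M x 1 @[M --> \oo] --> x * abel_sum.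
  by apply: cvgMl_tmp; exact: is_cvg_abel_psum.
apply: (cvgr_to_le cvgx).
by near=> M; exact: abel_psum_bound.
Unshelve. all: end_near. Qed.

(** The converse of [abel_psumS_le_expR], by the same comparison: the N-th power
    of a partial sum at 1/N is at most a longer partial sum at 1.  The
    inequality [expR_frac_le] gives the lower bound exp (t / (1 + t / N)) for
    (1 + t / N)^N. *)
Lemma expR_abel_psum_le M : expR (x * abel_psum M x 1) <= abel_sum.
Proof.
set t := x * _.
have t0 : 0 <= t by rewrite mulr_ge0 // abel_psum_ge0.
have cvgh : expR (t / (1 + harmonic N * t)) @[N --> \oo] --> expR t.
  have -> : expR t = expR (t / (1 + 0 * t)) by rewrite mul0r addr0 divr1.
  apply: (cvg_comp (fun N => t / (1 + harmonic N * t)) expR); last exact: continuous_expR.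
  apply: cvgMl_tmp; apply: cvgV; first by rewrite mul0r addr0 oner_neq0.
  by apply: cvgD; [exact: cvg_cst|apply: cvgMr_tmp; exact: cvg_harmonic].
apply: (cvgr_to_le cvgh).
near=> N; pose h : F := N.+1%:R^-1.
have h0 : 0 <= h by rewrite invr_ge0 ler0n.
have hN : h *+ N.+1 = 1 by rewrite -mulr_natr mulVf // pnatr_eq0.
rewrite /= -/h.
apply: le_trans (nondecreasing_cvgn_le abel_psum_nondecreasing is_cvg_abel_psum
  (M.+1 * N.+1).+1).
rewrite -[X in abel_psum _ _ X]hN; apply: le_trans (abel_psum_exp_le _ _ x0 h0).
have -> : t / (1 + h * t) = N.+1%:R * ((h * t) / (1 + h * t)).
  by rewrite !mulrA [N.+1%:R * h]mulr_natl hN mul1r.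
rewrite expRM_natl abel_psum_slope; apply: lerXn2r.
- by rewrite nnegrE expR_ge0.
- by rewrite nnegrE addr_ge0 // mulr_ge0 // abel_slope_ge0.
apply: le_trans (expR_frac_le _) _; first exact: mulr_ge0.
by rewrite lerD2l ler_wpM2l // /t -abel_slope0 le_abel_slope.
Unshelve. all: end_near. Qed.

(** With T = x L this is T = x e^T, the equation of the exponential generating
    function T of rooted labelled trees. *)
Lemma abel_sum_expR : abel_sum = expR (x * abel_sum).
Proof.
have cvgx : expR (x * abel_psum M x 1) @[M --> \oo] --> expR (x * abel_sum).
  apply: (cvg_comp (fun M => x * abel_psum M x 1) expR); last exact: continuous_expR.
  by apply: cvgMl_tmp; exact: is_cvg_abel_psum.
apply/eqP; rewrite eq_le; apply/andP; split.
  apply: limr_le; first exact: is_cvg_abel_psum.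
  near=> M; apply: le_trans (abel_psum_nondecreasing (leqnSn M)) _.
  apply: le_trans (abel_psumS_le_expR M x0) _; rewrite ler_expR ler_wpM2l //.
  exact: nondecreasing_cvgn_le abel_psum_nondecreasing is_cvg_abel_psum M.
apply: (cvgr_to_le cvgx).
by near=> M; exact: expR_abel_psum_le.
Unshelve. all: end_near. Qed.

End Converge.
End TreeSeries.

(** * The Lambert function *)

Section Lambert.
Variable F : realType.
Implicit Types w x p : F.

(** The function w e^w is increasing from -1 on; with d = v - u this reduces to
    1 + d < e^d for v >= 0 and to 1 - d < e^(-d) for v < 0. *)
Lemma mul_expR_inj w1 w2 : -1 <= w1 -> -1 <= w2 ->
  w1 * expR w1 = w2 * expR w2 -> w1 = w2.
Proof.
suff lt (u v : F) : -1 <= u -> u < v -> u * expR u < v * expR v.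
  move=> h1 h2 E; have [/(lt _ _ h1)|/(lt _ _ h2)|//] := ltgtP w1 w2.
    by rewrite E ltxx.
  by rewrite E ltxx.
move=> u1 uv; pose d := v - u.
have d0 : 0 < d by rewrite subr_gt0.
have -> : v = u + d by rewrite /d addrC subrK.
rewrite expRD mulrA mulrAC ltr_pM2r ?expR_gt0 //.
have [ud0|ud0] := leP 0 (u + d).
  by have := expR_gt1Dx (lt0r_neq0 d0); nra.
have : 1 - d < expR (- d) by apply: expR_gt1Dx; rewrite oppr_eq0 lt0r_neq0.
rewrite expRN => Hd.
have ed := expR_gt0 d.
have : (1 - d) * expR d < 1 by rewrite -ltr_pdivlMr // div1r.
nra.
Qed.

Lemma lambertW0_eq w : -1 <= w -> lambertW0 (w * expR w) = w.
Proof.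
move=> w1; by apply: xget_unique => //= u [u1 /(mul_expR_inj u1 w1)].
Qed.

Section Branch.
Variable p : F.
Hypothesis p01 : 0 <= p <= 1.

Let x := p / expR 1.

Lemma div_expR1_ge0 : 0 <= x.
Proof. by case/andP: p01 => p0 _; rewrite divr_ge0 ?expR_ge0. Qed.

Lemma div_expR1_le : x <= expR (-1).
Proof.
case/andP: p01 => p0 p1.
by rewrite /x expRN -[leRHS]mul1r ler_wpM2r // invr_ge0 expR_ge0.
Qed.

Let T := x * abel_sum x.

Lemma mul_abel_sum_lambert : - T * expR (- T) = - x.
Proof.
rewrite /T mulNr expRN -(abel_sum_expR div_expR1_ge0 div_expR1_le) mulfK //.
by rewrite (abel_sum_expR div_expR1_ge0 div_expR1_le) gt_eqF ?expR_gt0.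
Qed.

Lemma N1_le_abel_sum : -1 <= - T.
Proof. by rewrite lerN2; apply: abel_sum_bound div_expR1_ge0 div_expR1_le. Qed.

Lemma abel_sum_lambert : abel_sum x = lambert_ratio p.
Proof.
rewrite /lambert_ratio; have [p0|p0] := eqVneq p 0.
  by rewrite (abel_sum_expR div_expR1_ge0 div_expR1_le) /x p0 !mul0r expR0.
rewrite -/x -mul_abel_sum_lambert (lambertW0_eq N1_le_abel_sum) mulrNN /T /x.
by rewrite mulrA mulrA divfK // mulfV ?mul1r // gt_eqF ?expR_gt0.
Qed.

Lemma abel_sum_critical : p = 1 -> abel_sum x = expR 1.
Proof.
move=> p1; have xE : x = expR (-1) by rewrite /x p1 div1r expRN.
have : - T = -1.
  apply: mul_expR_inj; rewrite ?N1_le_abel_sum //.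
  by rewrite mul_abel_sum_lambert xE mulN1r.
move/oppr_inj; rewrite (abel_sum_expR div_expR1_ge0 div_expR1_le) -/T => ->.
by [].
Qed.

Lemma lambert_partial_sumS N : lambert_partial_sum p N.+1 = abel_psum N x 1.
Proof.
rewrite /lambert_partial_sum big_add1 big_mkord; apply: eq_bigr => m _.
by rewrite abel1_exp.
Qed.

Lemma cvg_lambert_partial_sum : lambert_partial_sum p @ \oo --> abel_sum x.
Proof.
rewrite -cvg_shiftS /=; under eq_fun do rewrite lambert_partial_sumS.
exact: is_cvg_abel_psum div_expR1_ge0 div_expR1_le.
Qed.

End Branch.
End Lambert.

(** * Dominated convergence of the one-point functions *)

Section Tannery.
Variable F : realType.

(** Dominated convergence for sums of growing length (Tannery's theorem). *)
Lemma tannery (f : nat -> nat -> F) (g a : nat -> F) (l : F) :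
  (forall m, f n m @[n --> \oo] --> g m) ->
  (\forall n \near \oo, forall m, `|f n m| <= a m) ->
  cvgn (series a) -> series g @ \oo --> l ->
  \sum_(m < n.+1) f n m @[n --> \oo] --> l.
Proof.
move=> fg fa cva cvg; apply/cvgrPdist_lt => e e0.
have e3 : 0 < e / 3 by rewrite divr_gt0.
have a0 m : 0 <= a m.
  by near \oo => n; apply: le_trans (normr_ge0 (f n m)) _; near: n; apply: filterS fa.
near \oo => N.
have gN : `|l - series g N| < e / 3.
  by near: N; move/cvgrPdist_lt : cvg; apply.
have aN n : \sum_(N <= m < n) a m < e / 3.
  have [nN|Nn] := leqP n N; first by rewrite big_geq.
  have : `|limn (series a) - series a N| < e / 3.
    by near: N; move/cvgrPdist_lt : cva; apply.
  apply: le_lt_trans; apply: le_trans (ler_norm _).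
  rewrite lerBrDl /series /= -big_cat_nat //=; last exact: ltnW.
  by apply: (nondecreasing_cvgn_le _ cva n); apply: nondecreasing_series.
have fN : \sum_(0 <= m < N) f n m @[n --> \oo] --> series g N.
  by apply: cvg_big => [|m _]; [exact: add_continuous|exact: fg].
near=> n.
have Nn : (N <= n.+1)%N by near: n; apply: filterS (nbhs_infty_ge N) => n; exact: leqW.
have An : `|series g N - \sum_(0 <= m < N) f n m| < e / 3.
  by near: n; move/cvgrPdist_lt : fN; apply.
have fn m : `|f n m| <= a m by move: m; near: n.
rewrite -(big_mkord xpredT (f n)) (big_cat_nat (leq0n N) Nn) /=.
set A := \sum_(0 <= m < N) _; set B := \sum_(N <= m < _) _.
have -> : l - (A + B) = (l - series g N) + ((series g N - A) + (- B)) by ring.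
apply: le_lt_trans (ler_normD _ _) _; rewrite -[e](_ : e / 3 + (e / 3 + e / 3) = e); last by lra.
apply: ltrD => //; apply: le_lt_trans (ler_normD _ _) _; apply: ltrD => //.
rewrite normrN; apply: le_lt_trans (aN n.+1).
apply: le_trans (ler_norm_sum _ _ _) _; exact: ler_sum.
Unshelve. all: end_near. Qed.

End Tannery.

Section Asymptotics.
Variable F : realType.
Implicit Types (n m : nat) (q s d : F).

(** The probability that m independent uniform choices among n + 1 vertices are
    distinct and avoid the root. *)
Definition falling_ratio n m : F := (n ^_ m)%:R / n.+1%:R ^+ m.

Lemma falling_ratioS n m :
  falling_ratio n m.+1 = falling_ratio n m * ((n - m)%:R / n.+1%:R).
Proof. by rewrite /falling_ratio ffactnSr natrM exprSr invfM mulrACA. Qed.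

Lemma falling_ratio_ge0 n m : 0 <= falling_ratio n m.
Proof. by rewrite divr_ge0 ?exprn_ge0 ?ler0n. Qed.

Lemma natrB1 n m : (m <= n)%N ->
  (n - m)%:R / n.+1%:R = 1 - m.+1%:R / n.+1%:R :> F.
Proof.
move=> mn; rewrite -[X in X - _](@divff _ n.+1%:R) ?pnatr_eq0 // -mulrBl.
by rewrite -natrB // subSS.
Qed.

Lemma cvg_falling_ratio m : falling_ratio n m @[n --> \oo] --> (1 : F).
Proof.
elim: m => [|m IH].
  by under eq_fun do rewrite /falling_ratio ffactn0 expr0 divr1; exact: cvg_cst.
have ratio : (n - m)%:R / n.+1%:R @[n --> \oo] --> (1 : F).
  have : (1 - m.+1%:R * harmonic n : F) @[n --> \oo] --> (1 - m.+1%:R * 0 : F).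
    by apply: cvgB; [exact: cvg_cst|apply: cvgMl_tmp; exact: cvg_harmonic].
  rewrite mulr0 subr0; apply: cvg_trans; apply: near_eq_cvg; near=> n.
  by rewrite natrB1 //; near: n; exact: nbhs_infty_ge.
under eq_fun do rewrite falling_ratioS.
have := cvgM IH ratio; rewrite mulr1; exact.
Unshelve. all: end_near. Qed.

(** Each factor 1 - i / V is at most exp (- i / V), and 1 + ... + m is
    C(m+1,2). *)
Lemma falling_ratio_le n m :
  falling_ratio n m <= expR (- ('C(m.+1, 2)%:R / n.+1%:R)).
Proof.
elim: m => [|m IH].
  by rewrite /falling_ratio ffactn0 expr0 divr1 bin_small // mul0r oppr0 expR0.
rewrite falling_ratioS binS bin1 natrD mulrDl opprD expRD.
apply: ler_pM => //; rewrite ?falling_ratio_ge0 ?divr_ge0 ?ler0n //.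
have [mn|/ltnW nm] := leqP m n; first by rewrite natrB1 // expR_ge1Dx.
by move: nm; rewrite -subn_eq0 => /eqP ->; rewrite mul0r expR_ge0.
Qed.

(** The contribution to Gt of the trees with m edges; see [Gt_tree_term]. *)
Definition tree_term n m q : F :=
  (q / (expR 1 * n.+1%:R)) ^+ m *+ (m.+1 ^ m.-1) *+ 'C(n, m).

Lemma tree_termE n m q :
  tree_term n m q = abel m 1 * (q / expR 1) ^+ m * falling_ratio n m.
Proof.
rewrite /tree_term /falling_ratio abel1 invfM mulrA exprMn exprVn -bin_ffact natrM.
rewrite -mulr_natr -mulr_natr.
move: (m`!%:R : F) (fact_neq0 F m) => f f0.
move: ((q / expR 1) ^+ m) (n.+1%:R ^- m : F) ((m.+1 ^ m.-1)%:R : F) ('C(n, m)%:R : F).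
by move=> u v A B; field.
Qed.

Lemma cvg_tree_term (q_ : nat -> F) q m : q_ n @[n --> \oo] --> q ->
  tree_term n m (q_ n) @[n --> \oo] --> abel m 1 * (q / expR 1) ^+ m.
Proof.
move=> cq; under eq_fun do rewrite tree_termE.
have cqm : abel m 1 * (q_ n / expR 1) ^+ m @[n --> \oo] -->
    abel m 1 * (q / expR 1) ^+ m.
  apply: cvgMl_tmp; apply: (cvg_comp (fun n => q_ n / expR 1) (fun x => x ^+ m)).
    exact: cvgMr_tmp cq.
  exact: exprn_continuous.
have := cvgM cqm (cvg_falling_ratio m); rewrite mulr1; exact.
Qed.

Lemma natr_bin2 m : 'C(m.+1, 2)%:R = m%:R * (m%:R + 1) / 2 :> F.
Proof.
elim: m => [|m IH]; first by rewrite bin_small // !mul0r.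
by rewrite binS bin1 natrD IH -natr1; field.
Qed.

(** Here d stands for V^(-1/2).  With M = m d, the exponent collected from the
    factors is at most s M - (1 - 3/4) M^2 / 2, whose maximum over M is
    2 s^2, attained at M = 4 s. *)
Lemma tree_term_dominated n m s d q : 0 <= s -> 0 <= d -> d ^+ 2 = n.+1%:R^-1 ->
  `|q| <= 1 + s * d -> `|q| <= 3 / 2 ->
  tree_term n m `|q| * (1 + `|q| / (expR 1 * n.+1%:R)) ^+ 'C(m.+1, 2) <=
  expR (2 * s ^+ 2) * (abel m 1 * expR (-1) ^+ m).
Proof.
move=> s0 d0 d2 qs q2; set y := _ / (_ * _); set c := 'C(_, _).
have y0 : 0 <= y by rewrite divr_ge0 ?mulr_ge0 ?expR_ge0.
have e2 : 2 <= expR 1 :> F by apply: le_trans (expR_ge1Dx 1); lra.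
have y1 : y <= 3 / 4 * d ^+ 2.
  rewrite /y invfM mulrA -d2 ler_wpM2r ?exprn_ge0 //.
  rewrite ler_pdivrMr ?expR_gt0 //; nra.
have qm : (`|q| / expR 1) ^+ m <= expR (m%:R * (s * d)) * expR (-1) ^+ m.
  rewrite exprMn expRN ler_wpM2r ?exprn_ge0 ?invr_ge0 ?expR_ge0 // expRM_natl.
  apply: lerXn2r; rewrite ?nnegrE ?expR_ge0 //.
  exact: le_trans qs (expR_ge1Dx _).
have yc : (1 + y) ^+ c <= expR (c%:R * y).
  rewrite expRM_natl; apply: lerXn2r; rewrite ?nnegrE ?expR_ge0 ?addr_ge0 //.
  exact: expR_ge1Dx.
have fr := falling_ratio_le n m; rewrite -/c -d2 in fr.
have A0 : 0 <= abel m 1 :> F by rewrite abel_ge0.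
rewrite tree_termE.
apply: (@le_trans _ _ (abel m 1 * (expR (m%:R * (s * d)) * expR (-1) ^+ m) *
   expR (- (c%:R * d ^+ 2)) * expR (c%:R * y))).
  apply: ler_pM => //;
    rewrite ?mulr_ge0 ?exprn_ge0 ?addr_ge0 ?falling_ratio_ge0 ?divr_ge0 ?expR_ge0 //.
  apply: ler_pM => //; rewrite ?mulr_ge0 ?exprn_ge0 ?falling_ratio_ge0 ?divr_ge0 ?expR_ge0 //.
  by apply: ler_wpM2l.
rewrite [leLHS](_ : _ = expR (m%:R * (s * d) - c%:R * d ^+ 2 + c%:R * y) *
   (abel m 1 * expR (-1) ^+ m)); last by rewrite !expRD; ring.
rewrite ler_wpM2r ?mulr_ge0 ?exprn_ge0 ?expR_ge0 // ler_expR.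
have c2 : m%:R ^+ 2 / 2 <= c%:R :> F.
  by rewrite /c natr_bin2; have := ler0n F m; nra.
have c0 : 0 <= c%:R :> F by [].
have := ler_wpM2l c0 y1.
have := ler_wpM2r (sqr_ge0 d) c2.
have := sqr_ge0 (m%:R * d - 4 * s).
move: (m%:R : F) (c%:R : F) => M C; nra.
Qed.

End Asymptotics.

Section Limit.
Variable F : realType.

Lemma Gt_tree_term n (q : F) : Gt n.+1 q = \sum_(m < n.+1) tree_term n m q.
Proof. exact: Gt_sum. Qed.

Lemma normr_tree_term n m (q : F) : `|tree_term n m q| = tree_term n m `|q|.
Proof.
rewrite /tree_term !normrMn normrX normrM normfV.
by rewrite (@ger0_norm _ (_ * _)) // mulr_ge0 ?expR_ge0.
Qed.

Lemma tree_term_ge0 n m (q : F) : 0 <= q -> 0 <= tree_term n m q.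
Proof.
by move=> q0; rewrite !mulrn_wge0 // exprn_ge0 // divr_ge0 // mulr_ge0 ?expR_ge0.
Qed.

Lemma Ga_sub_Gt_tree_term n (q : F) :
  `|Ga n.+1 q - Gt n.+1 q| <= \sum_(m < n.+1)
    tree_term n m `|q| * ((1 + `|q| / (expR 1 * n.+1%:R)) ^+ 'C(m.+1, 2) - 1).
Proof.
apply: le_trans (Ga_sub_Gt n q) _; rewrite le_eqVlt; apply/orP; left; apply/eqP.
by apply: eq_bigr => m _; rewrite /tree_term !mulrnAl.
Qed.

Lemma series_abel (x : F) M : series (fun m => abel m 1 * x ^+ m) M = abel_psum M x 1.
Proof. by rewrite /series /= big_mkord. Qed.

Section Sequence.
Variables (s : F) (q_ : nat -> F) (p : F).
Hypotheses (s0 : 0 <= s) (p01 : 0 <= p <= 1).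
Hypothesis q_le : \forall n \near \oo, q_ n <= 1 + s * n.+1%:R `^ (- (1 / 2)).
Hypothesis cvgq : q_ n @[n --> \oo] --> p.

(** The dominating sequence: a multiple of the tree series at x = 1/e. *)
Let a m : F := expR (2 * s ^+ 2) * (abel m 1 * expR (-1) ^+ m).

Lemma cvg_series_dominant : cvgn (series a).
Proof.
have -> : a = expR (2 * s ^+ 2) *: (fun m => abel m 1 * expR (-1) ^+ m) :> (nat -> F).
  exact/funext.
apply: is_cvg_seriesZ; rewrite (_ : series _ = fun M => abel_psum M (expR (-1)) 1).
  by apply: is_cvg_abel_psum; rewrite ?expR_ge0.
by apply/funext => M; rewrite series_abel.
Qed.

Lemma near_dominated : \forall n \near \oo, forall m,
  tree_term n m `|q_ n| * (1 + `|q_ n| / (expR 1 * n.+1%:R)) ^+ 'C(m.+1, 2) <= a m.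
Proof.
case/andP: p01 => p0 p1; near=> n => m.
have qp : `|p - q_ n| < 1 / 2.
  by near: n; move/cvgrPdist_lt : cvgq; apply; rewrite divr_gt0.
have qle : q_ n <= 1 + s * n.+1%:R `^ (- (1 / 2)) by near: n.
have d0 := powR_ge0 (n.+1%:R : F) (- (1 / 2)).
apply: (tree_term_dominated m s0 d0).
- by rewrite powRN div1r powR12_sqrt ?ler0n // exprVn sqr_sqrtr ?ler0n.
- have := mulr_ge0 s0 d0; rewrite ler_norml qle andbT.
  by move: qp; rewrite ltr_norml => /andP[]; lra.
- by move: qp; rewrite ltr_norml ler_norml => /andP[]; lra.
Unshelve. all: end_near. Qed.

Lemma cvg_Gt : Gt n.+1 (q_ n) @[n --> \oo] --> abel_sum (p / expR 1).
Proof.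
under eq_fun do rewrite Gt_tree_term.
apply: (@tannery _ (fun n m => tree_term n m (q_ n)) _ _ _
  (fun m => @cvg_tree_term _ _ _ m cvgq) _ cvg_series_dominant).
  apply: filterS near_dominated => n + m => /(_ m); apply: le_trans.
  rewrite normr_tree_term ler_peMr ?tree_term_ge0 // exprn_ege1 // lerDl.
  by rewrite divr_ge0 ?mulr_ge0 ?expR_ge0.
rewrite (_ : series _ = fun M => abel_psum M (p / expR 1) 1).
  exact: is_cvg_abel_psum (div_expR1_ge0 p01) (div_expR1_le p01).
by apply/funext => M; rewrite series_abel.
Qed.

Lemma cvg_Ga_sub_Gt : Ga n.+1 (q_ n) - Gt n.+1 (q_ n) @[n --> \oo] --> (0 : F).
Proof.
pose y n := `|q_ n| / (expR 1 * n.+1%:R).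
have y0 n : 0 <= y n by rewrite divr_ge0 ?mulr_ge0 ?expR_ge0.
pose f n m := tree_term n m `|q_ n| * ((1 + y n) ^+ 'C(m.+1, 2) - 1).
have cvgf : \sum_(m < n.+1) f n m @[n --> \oo] --> (0 : F).
  have cvgy : y n @[n --> \oo] --> `|p| / expR 1 * 0.
    under eq_fun do rewrite /y invfM mulrA.
    apply: cvgM; last exact: cvg_harmonic.
    by apply: cvgMr_tmp; exact: cvg_norm.
  rewrite mulr0 in cvgy.
  apply: (@tannery _ f (fun=> 0) _ _ _ _ cvg_series_dominant).
  - move=> m; have cpow : (1 + y n) ^+ 'C(m.+1, 2) - 1 @[n --> \oo] --> (0 : F).
      have c1 : 1 + y n @[n --> \oo] --> (1 + 0 : F) by apply: cvgD => //; exact: cvg_cst.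
      have c2 : (1 + y n) ^+ 'C(m.+1, 2) @[n --> \oo] --> (1 + 0 : F) ^+ 'C(m.+1, 2).
        by apply: (cvg_comp (fun n => 1 + y n) (fun x => x ^+ _) c1); exact: exprn_continuous.
      rewrite -(subrr 1); apply: cvgB; last exact: cvg_cst.
      by rewrite addr0 expr1n in c2.
    have := cvgM (@cvg_tree_term _ _ _ m (cvg_norm cvgq)) cpow.
    by rewrite mulr0; exact.
  - apply: filterS near_dominated => n + m => /(_ m); apply: le_trans.
    have Y1 : 1 <= (1 + y n) ^+ 'C(m.+1, 2) by rewrite exprn_ege1 // lerDl.
    rewrite /f normrM normr_tree_term normr_id [`|_ - 1|]ger0_norm ?subr_ge0 //.
    by rewrite ler_wpM2l ?tree_term_ge0 // -/(y n) gerBl.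
  - by rewrite (_ : series _ = fun=> 0); [exact: cvg_cst|];
    apply/funext => M; rewrite /series /= big1.
apply/cvgr0Pnorm_lt => e e0.
have near_lt : \forall n \near \oo, `|\sum_(m < n.+1) f n m| < e.
  by move/cvgr0Pnorm_lt : cvgf => /(_ e e0).
near=> n.
apply: le_lt_trans (Ga_sub_Gt_tree_term _ _) _.
apply: le_lt_trans (ler_norm _) _.
by near: n; exact: near_lt.
Unshelve. all: end_near. Qed.

Lemma cvg_Ga : Ga n.+1 (q_ n) @[n --> \oo] --> abel_sum (p / expR 1).
Proof.
have : Ga n.+1 (q_ n) - Gt n.+1 (q_ n) + Gt n.+1 (q_ n) @[n --> \oo] -->
    0 + abel_sum (p / expR 1).
  by apply: cvgD; [exact: cvg_Ga_sub_Gt|exact: cvg_Gt].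
rewrite add0r; apply: cvg_trans; apply: near_eq_cvg; apply: nearW => n.
by rewrite subrK.
Qed.

End Sequence.
End Limit.

Theorem theorem1p2 (R : realType) (G : forall V : nat, R -> R)
    (hG : G = @Gt R \/ G = @Ga R)
    (s : R) (hs : 0 <= s) (p_ : nat -> R) (p : R)
    (hp_ : forall V : nat, (2 <= V)%N -> p_ V <= 1 + s * V%:R `^ (- (1 / 2)))
    (hcvg : p_ V @[V --> \oo] --> p)
    (hp : 0 <= p <= 1) :
  [/\ cvgn (lambert_partial_sum p),
      G V (p_ V) @[V --> \oo] --> limn (lambert_partial_sum p),
      limn (lambert_partial_sum p) = lambert_ratio p &
      p = 1 -> G V (p_ V) @[V --> \oo] --> (expR 1 : R)].
Proof.
have cvgL := cvg_lambert_partial_sum hp.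
have EL : limn (lambert_partial_sum p) = abel_sum (p / expR 1) by apply: cvg_lim.
have cvgG : G V (p_ V) @[V --> \oo] --> abel_sum (p / expR 1).
  have cvgq : p_ n.+1 @[n --> \oo] --> p by rewrite -cvg_shiftS in hcvg.
  have qle : \forall n \near \oo, p_ n.+1 <= 1 + s * n.+1%:R `^ (- (1 / 2)).
    by near=> n; apply: hp_; rewrite ltnS; near: n; exact: nbhs_infty_ge.
  rewrite -cvg_shiftS /=.
  by case: hG => ->; [exact: cvg_Gt hs hp qle cvgq|exact: cvg_Ga hs hp qle cvgq].
split.
- by apply/cvg_ex; exists (abel_sum (p / expR 1)).
- by rewrite EL.
- by rewrite EL abel_sum_lambert.
- by move=> p1; rewrite -(abel_sum_critical hp p1).
Unshelve. all: end_near. Qed.
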